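(* Let $K$ be an infinite field with $\mathrm{char}(K)=2$, let $Q\in\mathcal{Q}(n,d,m)$, and let $h$ be a closed path in $Q$ with $h\not\equiv0$. Then $\deg(h)\leq 2m(d-n)+m$.
   Context: A quiver $Q$ is a finite oriented graph; for an arrow $a$, $a''$ is its tail and $a'$ its head. A path $a=a_1\cdots a_s$ ($a_i$ arrows) satisfies $a_i'=a_{i+1}''$; it is closed (in the vertex $a_1''$) if $a_1''=a_s'$; $\deg(a)=s$, $V(a)=\{a_1'',a_1',\dots,a_s'\}$. A closed path is primitive if each vertex of $V(a)$ is the head of exactly one $a_i$. $m(Q)$ is the maximal degree of a primitive closed path; $Q$ is strongly connected if some closed path contains all vertices; $\mathcal{Q}(n,d,m)$ is the set of strongly connected quivers with $n$ vertices, $d$ arrows and $m(Q)=m$. Closed paths are incident if they are closed in the same vertex. The equivalence $\equiv$ (for $\mathrm{char}(K)=2$) is the equivalence relation on the set of closed paths of $Q$ together with the symbol $0$ generated by: (1) $ab\equiv ba$ for paths $a,b$ such that $ab$ is a closed path; (2) $a_{\sigma(1)}\cdots a_{\sigma(t)}\equiv a_1\cdots a_t$ for incident closed paths $a_1,\dots,a_t$, $t\geq2$, $\sigma\in S_t$; (3) $a_1^2a_2\equiv0$ for incident closed paths $a_1,a_2$; (4) $a_1^2\equiv0$ for every closed path $a_1$. *)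

(* Defs.v *)
From mathcomp Require Import all_boot all_algebra.
Set Implicit Arguments. Unset Strict Implicit. Unset Printing Implicit Defensive.

(* A quiver with vertex set 'I_n and arrow set 'I_d, given by
   tl a = a'' (tail) and hd a = a' (head).  Paths are nonempty sequences of
   arrows a_1 ... a_s with a_i' = a_{i+1}''. *)
Section Quiver.
Variables (n d : nat) (tl hd : 'I_d -> 'I_n).

Definition is_path (p : seq 'I_d) : bool :=
  (p != [::]) && sorted (fun a b => hd a == tl b) p.

Definition is_closed (p : seq 'I_d) : bool :=
  if p is a :: _ then is_path p && (tl a == hd (last a p)) else false.

Definition closed_in (v : 'I_n) (p : seq 'I_d) : bool :=
  if p is a :: _ then is_closed p && (tl a == v) else false.

Definition verts (p : seq 'I_d) : seq 'I_n :=
  if p is a :: _ then tl a :: map hd p else [::].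

Definition primitive (p : seq 'I_d) : bool :=
  is_closed p && all (fun v => count (fun a => hd a == v) p == 1) (verts p).

Definition mQ_is (m : nat) : Prop :=
  (exists p, primitive p /\ size p = m) /\
  (forall p, primitive p -> size p <= m).

Definition strongly_connected : Prop :=
  exists p, is_closed p /\ forall v : 'I_n, v \in verts p.

Definition in_Qndm (m : nat) : Prop := strongly_connected /\ mQ_is m.

(* The equivalence relation on closed paths together with 0 (= None),
   generated by rules (1)-(4). *)
Inductive qequiv : option (seq 'I_d) -> option (seq 'I_d) -> Prop :=
| qe_refl x : qequiv x x
| qe_sym x y : qequiv x y -> qequiv y x
| qe_trans x y z : qequiv x y -> qequiv y z -> qequiv x z
| qe_rot (a b : seq 'I_d) : is_path a -> is_path b -> is_closed (a ++ b) ->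
    qequiv (Some (a ++ b)) (Some (b ++ a))
| qe_perm (v : 'I_n) (ls ls' : seq (seq 'I_d)) : 2 <= size ls ->
    all (closed_in v) ls -> perm_eq ls ls' ->
    qequiv (Some (flatten ls')) (Some (flatten ls))
| qe_sq_mul (v : 'I_n) (a1 a2 : seq 'I_d) : closed_in v a1 -> closed_in v a2 ->
    qequiv (Some (a1 ++ a1 ++ a2)) None
| qe_sq (a1 : seq 'I_d) : is_closed a1 -> qequiv (Some (a1 ++ a1)) None.

End Quiver.

(* Main.v *)
(** Work with closed paths up to rotation and permutation of loops based at a
common vertex, and call such a path null if it can be brought to the form
[a a b] with [a] a nonempty loop; a null path is equivalent to 0.

(i) If every arrow of a factor occurs at least twice in that factor, the path
is null: a repeated factor of maximal length could always be lengthened by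
permuting loops.  (ii) Hence a non-null path can be written [e h'] with [e] a
primitive loop through an arrow that does not occur in [h']: take [e] shortest
among the loops through an arrow of multiplicity one; if [e] had a proper
subloop, then a maximal run of arrows repeated inside [e] would contradict (i).
(iii) If [e h'] is not null, then either [h'] is not null or [h'] is of the
form [a a b] with [a] primitive, and then [a b] is not null.

So removing at most two primitive loops, of total degree at most [2 m], leaves
a non-null path (or nothing) that has lost an arrow.  The number of arrows
minus the number of vertices of the support drops strictly, and it is at most
[d - n] at the start; when it cannot drop any more, the path is primitive. *)

Require Import Defs.
From Stdlib Require Import Classical.
From mathcomp Require Import all_boot all_algebra zify.
Set Implicit Arguments. Unset Strict Implicit. Unset Printing Implicit Defensive.

(** * Walks with explicit endpoints, their splittings and subloops *)

Section Walks.
Variables (V A : eqType).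
Implicit Types (u v w s t : V) (x y z : A).

Variables (tl hd : A -> V).
Implicit Types (p q r a b c e f g h k : seq A).

(** Carrying both endpoints gives an empty walk at every vertex, so that gluing and splitting need
    no nonemptiness conditions. *)
Fixpoint walk u p v : bool :=
  if p is x :: q then (tl x == u) && walk (hd x) q v else u == v.

Lemma walk_nil v : walk v [::] v.
Proof. exact: eqxx. Qed.

Lemma walk_consE u x p v : u = tl x -> walk (hd x) p v -> walk u (x :: p) v.
Proof. by move=> -> /= ->; rewrite eqxx. Qed.

Lemma walk_cat u v w p q : walk u p w -> walk w q v -> walk u (p ++ q) v.
Proof.
elim: p u => [|x p IH] u /=; first by move=> /eqP->.
by case/andP=> -> /IH H /H ->.
Qed.

Lemma walk_conv u u' v v' p : u' = u -> v' = v -> walk u p v -> walk u' p v'.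
Proof. by move=> -> ->. Qed.

Lemma walk_catP u v p q :
  walk u (p ++ q) v -> exists w, walk u p w /\ walk w q v.
Proof.
elim: p u => [|x p IH] u /=; first by move=> H; exists u.
by case/andP=> -> /IH.
Qed.

Lemma walk_consP u x p v : walk u (x :: p) v -> u = tl x /\ walk (hd x) p v.
Proof. by move=> /= /andP[/eqP-> ->]. Qed.

Lemma walk_end u v w p : walk u p v -> walk u p w -> v = w.
Proof.
elim: p u => [|x p IH] u /=; first by move=> /eqP<- /eqP.
by case/andP=> _ H /andP[_ /(IH _ H)].
Qed.

Lemma walk_start u u' v v' p : p != [::] -> walk u p v -> walk u' p v' -> u = u'.
Proof. by case: p => //= x p _ /andP[/eqP-> _] /andP[/eqP-> _]. Qed.

Lemma walk_loop v w w' p : walk v p w -> walk w' p v -> walk v p v.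
Proof.
by case: p => [|x p] //= /andP[/eqP Ex _] /andP[_ ->]; rewrite Ex eqxx.
Qed.

Lemma walk_last u v x p : walk u (rcons p x) v -> v = hd x.
Proof. by rewrite -cats1 => /walk_catP[w [_ /= /andP[_ /eqP]]]. Qed.

Lemma walk_split u v w p : walk u p v -> w \in u :: map hd p ->
  exists p1 p2, [/\ p = p1 ++ p2, walk u p1 w & walk w p2 v].
Proof.
elim: p u => [|x p IH] u /=.
  by rewrite inE => /eqP<- /eqP->; exists [::], [::]; rewrite /= eqxx.
case/andP=> /eqP<- Hp; rewrite inE => /orP[/eqP->|Hw].
  by exists [::], (x :: p); rewrite /= !eqxx.
have [p1 [p2 [-> H1 H2]]] := IH _ Hp Hw.
by exists (x :: p1), p2; rewrite /= eqxx.
Qed.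

Lemma walk_tl u v p x : walk u p v -> x \in p -> tl x \in u :: map hd p.
Proof.
elim: p u => [|y p IH] u //= /andP[/eqP<- Hp].
rewrite inE => /orP[/eqP->|/(IH _ Hp) Hx]; first exact: mem_head.
by rewrite inE Hx orbT.
Qed.

(** Two arrows with the same head enclose a loop [q]. The earlier one lies in [p1], so [q] is
    strictly shorter than [p], which drives later inductions. *)
Lemma nonuniq_loop u v p : walk u p v -> ~~ uniq (map hd p) ->
  exists w p1 q p2, [/\ p = p1 ++ q ++ p2, q != [::], p1 != [::],
    walk w q w & walk u p1 w /\ walk w p2 v].
Proof.
elim: p u => [|x p IH] u //= /andP[/eqP<- Hp]; rewrite negb_and negbK.
case/orP=> [Hx|/(IH _ Hp)].
  have [y yp Ey] := mapP Hx.
  case/splitPr: yp Hp => p1 p2 Hp.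
  exists (hd x), [:: x], (rcons p1 y), p2; rewrite cat_rcons /=.
  have [w [H1 /walk_consP[Ew H2]]] := walk_catP Hp.
  rewrite !eqxx Ey H2 -cats1; split=> //; first by case: (p1).
  by apply: (walk_cat (w := w)); rewrite -Ey //= Ew Ey !eqxx.
case=> [w [p1 [q [p2 [-> Hq Hp1 Hw [H1 H2]]]]]].
by exists w, (x :: p1), q, p2; rewrite /= eqxx H1.
Qed.

Lemma closed_heads u p : p != [::] -> walk u p u -> u :: map hd p =i map hd p.
Proof.
move=> Np Wp w; rewrite inE; case: eqP => [->|//]; apply/esym.
case/lastP: p Np Wp => // p x _ /walk_last->.
by rewrite map_rcons mem_rcons mem_head.
Qed.

Lemma uniq_map_inj p : uniq (map hd p) -> {in p &, injective hd}.
Proof.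
elim: p => //= z p IH /andP[zp Up] x y; rewrite !inE.
case/orP=> [/eqP->|xp] /orP[/eqP->|yp] E //; last exact: IH.
- by rewrite E map_f in zp.
- by rewrite -E map_f in zp.
Qed.

Lemma cat_cases p q p' q' : p ++ q = p' ++ q' ->
  (exists r, p' = p ++ r /\ q = r ++ q') \/ (exists r, p = p' ++ r /\ q' = r ++ q).
Proof.
elim: p p' => [|x p IH] [|y p'] /=.
- by move=> ->; left; exists [::].
- by move=> ->; left; exists (y :: p').
- by move=> <-; right; exists (x :: p).
- by case=> -> /IH[[r [-> ->]]|[r [-> ->]]]; [left|right]; exists r.
Qed.

Lemma count2_split x p : 1 < count_mem x p ->
  exists p1 p2 p3, p = p1 ++ x :: p2 ++ x :: p3.
Proof.
move=> H; have xp: x \in p by rewrite -has_pred1 has_count; lia.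
case/splitPr: xp H => p1 p2; rewrite count_cat /= eqxx => H.
have [xp|/count_memPn H1] := boolP (x \in p1).
  case/splitPr: xp H => q1 q2 _.
  by exists q1, q2, p2; rewrite -catA.
have xp: x \in p2 by rewrite -has_pred1 has_count; lia.
by case/splitPr: xp H => q1 q2 _; exists p1, q1, q2.
Qed.

End Walks.
Arguments walk : simpl never.

(** Breaks walks along concatenations and identifies the endpoints; [wk] below glues such pieces
    together again. *)
Ltac unwalk := repeat match goal with
  | H : is_true (walk _ _ _ (_ ++ _) _) |- _ => case/walk_catP: H => ? [? ?]
  | H : is_true (walk _ _ _ (_ :: _) _) |- _ => case/walk_consP: H => ? ?; subst
  | H : is_true (walk _ _ _ [::] _) |- _ => move/eqP: H => ?; subst
  | H : is_true (walk _ _ ?u ?p ?v), H' : is_true (walk _ _ ?u ?p ?w) |- _ =>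
      tryif constr_eq v w then fail else (have ? := walk_end H H'; subst)
  end.

Ltac catn := rewrite /=; do ?rewrite -catA /=.

Ltac wk := catn; solve [repeat first
  [ eassumption | exact: walk_nil | eapply walk_cat; [eassumption|]
  | apply: walk_consE; [congruence|]
  | match goal with
    | H : is_true (walk _ _ _ ?p _) |- is_true (walk _ _ _ ?p _) =>
        apply: (walk_conv _ _ H); congruence
    | H : is_true (walk _ _ _ ?p _) |- is_true (walk _ _ _ (?p ++ _) _) =>
        refine (walk_cat (walk_conv _ (erefl _) H) _); [congruence|]
    end ]].

(** * Shuffles of closed paths and null paths *)

Section Shuffle.
Variables (V A : eqType) (tl hd : A -> V).
Implicit Types (u v w s t : V) (x y z : A).
Implicit Types (p q r a b c e f g h k : seq A).
Local Notation walk := (walk tl hd).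

Inductive shuf : seq A -> seq A -> Prop :=
| shuf_refl p : shuf p p
| shuf_trans q p r : shuf p q -> shuf q r -> shuf p r
| shuf_rot u v p q : walk u p v -> walk v q u -> shuf (p ++ q) (q ++ p)
| shuf_swap v a b r : walk v a v -> walk v b v -> walk v r v ->
    shuf (a ++ b ++ r) (b ++ a ++ r).

Lemma shuf_perm p q : shuf p q -> perm_eq p q.
Proof.
elim=> {p q} [//|q p r _ H1 _ H2|u v p q _ _|v a b r _ _ _].
- exact: perm_trans H1 H2.
- by rewrite perm_catC.
- by rewrite perm_catCA.
Qed.

Lemma shuf_swap_mid u v p a b q : walk u p v -> walk v a v -> walk v b v ->
  walk v q u -> shuf (p ++ a ++ b ++ q) (p ++ b ++ a ++ q).
Proof.
move=> Hp Ha Hb Hq.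
have Hqp := walk_cat Hq Hp.
apply: (@shuf_trans ((a ++ b ++ q) ++ p)).
  apply: (@shuf_rot u v) => //.
  by apply: walk_cat Ha _; apply: walk_cat Hb _.
apply: (@shuf_trans ((b ++ a ++ q) ++ p)).
  by rewrite -!catA; apply: (shuf_swap Ha Hb).
apply: (@shuf_rot v u) => //.
by apply: walk_cat Hb _; apply: walk_cat Ha _.
Qed.

(** As [b] may be empty, this covers both square relations. *)
Definition null h : Prop := exists v a b,
  [/\ a != [::], walk v a v, walk v b v & shuf h (a ++ a ++ b)].

Lemma shuf_null h k : shuf h k -> null k -> null h.
Proof.
move=> H [v [a [b [Ha Wa Wb S]]]].
by exists v, a, b; split=> //; apply: shuf_trans H S.
Qed.

Lemma null_mid u v p a q : a != [::] -> walk u p v -> walk v a v -> walk v q u ->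
  null (p ++ a ++ a ++ q).
Proof.
move=> Ha Hp Wa Hq; exists v, a, (q ++ p); split=> //; first by wk.
by have := @shuf_rot u v p (a ++ a ++ q); rewrite -!catA; apply; wk.
Qed.

(** If [a = p1 q p2] with a loop [q], then [a a b] rotates to [q p2 p1 q p2 b p1], and swapping the
    loops [p2 p1] and [q] gives a square of the shorter [q]. *)
Lemma null_simple h : null h -> exists v a b,
  [/\ a != [::], uniq (map hd a), walk v a v, walk v b v & shuf h (a ++ a ++ b)].
Proof.
case=> v [a [b [Ha Wa Wb S]]].
have [m] := ubnP (size a); elim: m => // m IH in v a b Ha Wa Wb S *.
move=> Hm; have [Ua|/(nonuniq_loop Wa)] := boolP (uniq (map hd a)).
  by exists v, a, b.
case=> w [p1 [q [p2 [Ea Hq Hp1 Wq [W1 W2]]]]].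
apply: (IH w q (p2 ++ p1 ++ p2 ++ b ++ p1)) => //; first by wk.
- apply: shuf_trans S _; rewrite {}Ea.
  apply: (@shuf_trans (q ++ p2 ++ p1 ++ q ++ p2 ++ b ++ p1)).
    have := @shuf_rot v w p1 (q ++ p2 ++ p1 ++ q ++ p2 ++ b).
    by rewrite -!catA; apply; wk.
  have := @shuf_swap_mid w w q (p2 ++ p1) q (p2 ++ b ++ p1) Wq.
  by rewrite -!catA; apply; wk.
- move: Hm; rewrite Ea !size_cat; case: (p1) Hp1 => //= *; lia.
Qed.


(** The generators move blocks, and [c] is carried along with the block that contains its insertion
    point. *)
Lemma shuf_insert h k : shuf h k -> forall v c p q u, walk v c v ->
  h = p ++ q -> walk u p v -> walk v q u ->
  exists p' q' u', [/\ k = p' ++ q', walk u' p' v, walk v q' u'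
    & shuf (p ++ c ++ q) (p' ++ c ++ q')].
Proof.
elim=> {h k} [h|h1 h k _ IH1 _ IH2|u0 v0 p0 q0 _ _|v0 a b r Wa Wb Wr] v c p q u Wc.
- by move=> -> Wp Wq; exists p, q, u; split=> //; exact: shuf_refl.
- move=> E Wp Wq; have [p' [q' [u' [E' Wp' Wq' S]]]] := IH1 _ _ _ _ _ Wc E Wp Wq.
  have [p2 [q2 [u2 [E2 Wp2 Wq2 S2]]]] := IH2 _ _ _ _ _ Wc E' Wp' Wq'.
  by exists p2, q2, u2; split=> //; apply: shuf_trans S S2.
- move=> E Wp Wq; have [[s0 [E1 E2]]|[s0 [E1 E2]]] := cat_cases E; subst; unwalk.
  + eexists s0, (q ++ p0), _; split; [by rewrite catA|wk|wk|].
    by have := @shuf_rot _ _ p0 (s0 ++ c ++ q); rewrite -!catA; apply; wk.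
  + eexists (q0 ++ p), s0, _; split; [by rewrite catA|wk|wk|].
    by have := @shuf_rot _ _ (p ++ c ++ s0) q0; rewrite -!catA; apply; wk.
(* An empty path does not determine its base vertex, so [v0 = u] is available only in the nonempty
   case. *)
- have [E0|N0] := eqVneq (a ++ b ++ r) [::].
    move=> E; rewrite E0 in E; case: p E => // E; case: q E => // _ Wp Wq.
    exists [::], [::], v; move: a b r E0 {Wa Wb Wr} => [|//] [|//] [|//] _.
    by split=> //; [wk|wk|exact: shuf_refl].
  move=> E Wp Wq.
  have Ev: v0 = u.
    apply: (walk_start (v := v0) (v' := u) N0); first by wk.
    by rewrite E; wk.
  subst v0.
  have [[s0 [E1 E2]]|[s0 [E1 E2]]] := cat_cases E.
    have [[s1 [E3 E4]]|[s1 [E3 E4]]] := cat_cases E2; subst; unwalk.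
      eexists (b ++ a ++ s1), q, _; split; [by rewrite -!catA|wk|wk|].
      by have := @shuf_swap _ a b (s1 ++ c ++ q); rewrite -!catA; apply; wk.
    eexists s0, (s1 ++ a ++ r), _; split; [by rewrite -!catA|wk|wk|].
    by have := @shuf_swap _ a (s0 ++ c ++ s1) r; rewrite -!catA; apply; wk.
  subst; unwalk.
  eexists (b ++ p), (s0 ++ r), _; split; [by rewrite -!catA|wk|wk|].
  by have := @shuf_swap _ (p ++ c ++ s0) b r; rewrite -!catA; apply; wk.
Qed.

(** Two cuts of one path at [v] bound a loop at [v], and [c] is swapped past it. *)
Lemma shuf_insert_any u v c p q u' p' q' : walk v c v ->
  walk u p v -> walk v q u -> walk u' p' v -> walk v q' u' ->
  p ++ q = p' ++ q' -> shuf (p ++ c ++ q) (p' ++ c ++ q').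
Proof.
move=> Wc Wp Wq Wp' Wq' /cat_cases[[s0 [E1 E2]]|[s0 [E1 E2]]]; subst.
- have Ws : walk v s0 v.
    by unwalk; apply: walk_loop; eassumption.
  by unwalk; have := @shuf_swap_mid _ _ p c s0 q'; rewrite -!catA; apply; wk.
- have Ws : walk v s0 v.
    by unwalk; apply: walk_loop; eassumption.
  by unwalk; have := @shuf_swap_mid _ _ p' s0 c q; rewrite -!catA; apply; wk.
Qed.

Lemma shuf_insert2 v c u p q u' p' q' : walk v c v ->
  shuf (p ++ q) (p' ++ q') ->
  walk u p v -> walk v q u -> walk u' p' v -> walk v q' u' ->
  shuf (p ++ c ++ q) (p' ++ c ++ q').
Proof.
move=> Wc S Wp Wq Wp' Wq'.
have [p2 [q2 [u2 [E2 Wp2 Wq2 S2]]]] := shuf_insert S Wc (erefl _) Wp Wq.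
apply: (shuf_trans S2); exact: (shuf_insert_any Wc Wp2 Wq2 Wp' Wq' (esym E2)).
Qed.

(* If [h'] is null, it reduces to [a a b]; removing one copy of [a] as well
   leaves [a b], which cannot be null again: in a form [f f g] of [a b] the
   removed factors [c a] could be reinserted outside of [f f]. *)
Lemma null_remove m v c h h' :
  (forall u a, a != [::] -> walk u a u -> uniq (map hd a) -> size a <= m) ->
  ~ null h -> h' != [::] -> walk v c v -> walk v h' v ->
  shuf h (c ++ h') ->
  exists u k, [/\ k != [::], walk u k u, ~ null k, {subset k <= h'}
    & size k <= size h' <= size k + m].
Proof.
move=> Hm Nh Nh' Wc Wh' S.
case: (classic (null h')) => [|Nu]; last first.
  by exists v, h'; split=> //; rewrite leqnn leq_addr.
case/null_simple=> x [a [b [Na Ua Wa Wb Sa]]].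
(* Inserting [c] into [a a b] must hit a copy of [a], since inside [b] the square would survive and
   [h] would be null. If the second copy is hit, it is swapped to the front. *)
have [a1 [a2 [Ea Wa1 Wa2 Sh]]] : exists a1 a2, [/\ a = a1 ++ a2, walk x a1 v,
    walk v a2 x & shuf h (a1 ++ c ++ a2 ++ a ++ b)].
  have [p' [q' [u' [E Wp Wq S2]]]] :=
    shuf_insert Sa Wc (erefl ([::] ++ h')) (walk_nil _ _ v) Wh'.
  have {S2}S3 := shuf_trans S S2.
  have Ex : x = u'.
    have N : a ++ a ++ b != [::] by case: (a) Na.
    by apply: (walk_start N (v := x) (v' := u')); [wk|rewrite E; wk].
  subst u'.
  have [[r1 [E1 E2]]|[r1 [E1 E2]]] := cat_cases E; last first.
    exists p', r1; split=> //; last by rewrite -E2.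
    by rewrite E1 in Wa; unwalk.
  have [[r2 [E3 E4]]|[r2 [E3 E4]]] := cat_cases E2.
    case: Nh; apply: (shuf_null S3); subst p' r1; rewrite -!catA.
    by apply: (null_mid (p := [::]) (u := x) (v := x)) => //; unwalk; wk.
  subst p' q'.
  have W1 : walk x r1 v by unwalk.
  have W2 : walk v r2 x by move: Wa; rewrite E3 => Wa; unwalk.
  exists r1, r2; split=> //; apply: (shuf_trans S3).
  have := @shuf_swap x a (r1 ++ c ++ r2) b.
  by rewrite -!catA; apply; wk.
exists x, (a ++ b); split.
- by case: (a) Na.
- by wk.
- case/null_simple=> y [f [g [Nf Uf Wf Wg Sf]]].
  (* At any vertex [w] of [a], [h] is [a b] with a loop [r] inserted there; [r] consists of [c] and
     the other copy of [a]. *)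
  have ins w e1 e2 : a = e1 ++ e2 -> walk x e1 w -> walk w e2 x ->
      exists r, walk w r w /\ shuf h (e1 ++ r ++ e2 ++ b).
    move=> E We1 We2; rewrite Ea in E.
    have [[s [E1 E2]]|[s [E1 E2]]] := cat_cases E.
      have Ws : walk v s w by rewrite E1 in We1; unwalk.
      exists (e2 ++ a1 ++ c ++ s); split; first by wk.
      apply: (shuf_trans Sh).
      clear E; subst e1 a2 a.
      have := @shuf_swap x (a1 ++ c ++ s ++ e2) (a1 ++ s ++ e2) b.
      by rewrite -!catA; apply; wk.
    have Ws : walk w s v by rewrite E1 in Wa1; unwalk.
    exists (s ++ c ++ a2 ++ e1); split; first by wk.
    by move: Sh; clear E; subst a1 e2 a; rewrite -!catA.
  (* At a common vertex [r] could be moved into [g], and the square [f f] would make [h] null. *)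
  have disj w : w \in x :: map hd a -> w \notin y :: map hd g.
    move=> wa; apply/negP=> wg.
    have [e1 [e2 [E We1 We2]]] := walk_split Wa wa.
    have [s [Ws Ss]] := ins _ _ _ E We1 We2.
    have [g1 [g2 [Eg Wg1 Wg2]]] := walk_split Wg wg.
    case: Nh; apply: (shuf_null Ss).
    have W0 : walk y (f ++ f ++ g1) w by wk.
    have We2' : walk w (e2 ++ b) x by wk.
    have Sf' : shuf (e1 ++ e2 ++ b) ((f ++ f ++ g1) ++ g2).
      by rewrite catA -E -!catA -Eg.
    apply: (shuf_null (shuf_insert2 Ws Sf' We1 We2' W0 Wg2)).
    rewrite -!catA.
    by apply: (null_mid (p := [::]) (u := y) (v := y)) => //; wk.
  have af : {subset a <= f}.
    move=> z za; have: z \in a ++ b by rewrite mem_cat za.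
    rewrite (perm_mem (shuf_perm Sf)) !mem_cat.
    have [//|_ /= zg] := boolP (z \in f).
    by have := disj _ (walk_tl Wa za); rewrite (walk_tl Wg zg).
  (* The loop [f] starts at [y], off [a], yet contains all arrows of [a]. Its first arrow [z] from
     [a] has a predecessor [z'] in [f]; heads in [f] being distinct, [z'] is the arrow of [a]
     entering the tail of [z], against the choice of [z]. *)
  have yNa : y \notin x :: map hd a.
    by apply/negP=> /disj; rewrite mem_head.
  have Hf : has (mem a) f.
    case: (a) Na af => // z a' _ af; apply/hasP; exists z; last exact: mem_head.
    by apply: af; rewrite mem_head.
  move: Wf Uf af; case: (split_find Hf) => z r r' za ra Wf Uf af.
  have {}za : z \in a by [].
  have tz := walk_tl Wa za.
  case/lastP: r => [|r z'] in ra Wf Uf af *.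
    by move: Wf; rewrite /= => /walk_consP[Ey _]; rewrite Ey tz in yNa.
  have Ez : hd z' = tl z.
    by move: Wf; rewrite -!cats1 -!catA /= => Wf; unwalk.
  rewrite -Ez (closed_heads Na Wa) in tz.
  have [z2 z2a E2] := mapP tz.
  have Ezz : z' = z2.
    apply: (uniq_map_inj Uf) => //; last exact: af.
    by rewrite mem_cat !(mem_rcons, inE) eqxx ?orbT.
  case/negP: ra; apply/hasP; exists z'; first by rewrite mem_rcons mem_head.
  by rewrite /= Ezz.
- move=> z; rewrite (perm_mem (shuf_perm Sa)) !mem_cat.
  by case/orP=> ->; rewrite ?orbT.
- rewrite (perm_size (shuf_perm Sa)) !size_cat.
  by have := Hm _ _ Na Wa Ua; clear; lia.
Qed.

End Shuffle.

(** * Reversal of paths and growth of repeated factors *)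

Section Reversal.
Variables (V A : eqType).
Implicit Types (tl hd : A -> V) (u v s t : V) (x y z : A).
Implicit Types (p q a b c e h k : seq A).

Lemma walk_rev tl hd u v p : walk tl hd u p v -> walk hd tl v (rev p) u.
Proof.
elim: p u => [|x p IH] u; first by move/eqP->; exact: walk_nil.
case/walk_consP=> -> /IH W; rewrite rev_cons -cats1.
by apply: walk_cat W _; rewrite /walk !eqxx.
Qed.

Lemma shuf_rev tl hd h k : shuf tl hd h k -> shuf hd tl (rev h) (rev k).
Proof.
elim=> {h k} [h|h h' k _ IH1 _ IH2|u v p q Wp Wq|v a b c Wa Wb Wc].
- exact: shuf_refl.
- exact: shuf_trans IH1 IH2.
- by rewrite !rev_cat; apply: shuf_rot (walk_rev Wq) (walk_rev Wp).
- have := @shuf_swap_mid _ _ hd tl v v (rev c) (rev b) (rev a) [::].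
  by rewrite !rev_cat -!catA !cats0; apply; rewrite ?walk_nil ?walk_rev.
Qed.

Lemma null_rev tl hd h : null tl hd h -> null hd tl (rev h).
Proof.
case=> v [a [b [Na Wa Wb /shuf_rev S]]]; apply: (shuf_null S).
have := @null_mid _ _ hd tl v v (rev b) (rev a) [::].
rewrite !rev_cat -!catA cats0; apply; rewrite ?walk_nil ?walk_rev //.
by rewrite -size_eq0 size_rev size_eq0.
Qed.

(** Let [y] and, for nonempty [c], [z] be the arrows following the two copies of [q]. All their
    occurrences leave the end of [q]; swapping loops based there makes both copies continue with the
    same arrow, unless a square appears. The condition on [a] and [c] excludes the case left to
    reversal. *)
Lemma grow_right tl hd s t a q b c e :
  q != [::] -> (c != [::]) || (a == [::]) ->
  walk tl hd s (a ++ q ++ b ++ q ++ c) t -> walk tl hd t e s ->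
  (forall x, x \in a ++ q ++ b ++ q ++ c ->
     1 < count_mem x (a ++ q ++ b ++ q ++ c)) ->
  null tl hd ((a ++ q ++ b ++ q ++ c) ++ e) \/
  exists a' q' b' c', [/\ size q' = (size q).+1,
    walk tl hd s (a' ++ q' ++ b' ++ q' ++ c') t &
    shuf tl hd ((a ++ q ++ b ++ q ++ c) ++ e)
               ((a' ++ q' ++ b' ++ q' ++ c') ++ e)].
Proof.
move=> Nq ac W We Hc.
have [w [Wa {}W]] := walk_catP W; have [u [Wq {}W]] := walk_catP W.
have [w' [Wb {}W]] := walk_catP W; have [u' [Wq' Wc]] := walk_catP W.
have Ew := walk_start Nq Wq Wq'; subst w'.
have Eu := walk_end Wq Wq'; subst u'.
case: b => [|y b] in W Wb Hc *.
  left; move/eqP: Wb => Ew; subst u; rewrite -!catA /=.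
  by apply: null_mid Wa Wq _ => //; wk.
have Hy : [|| y \in a, y \in q, y \in b | y \in c].
  have := Hc y; rewrite !mem_cat mem_head !orbT => /(_ isT).
  rewrite !count_cat /= eqxx => H.
  by rewrite -4!(has_pred1 y) !has_count; move: H; clear; lia.
(* An arrow of [q] leaving the end of [q] starts a loop [x :: q2], whose two copies can be made
   adjacent. *)
have loop_in_q x c' : x \in q -> u = tl x -> walk tl hd u c' t ->
    null tl hd ((a ++ q ++ (y :: b) ++ q ++ c') ++ e).
  move=> xq Eu Wc'; subst u; have [Ey Wb'] := walk_consP Wb.
  case/splitPr: xq Wq Wb {Nq Wq' W Hy Hc} => q1 q2 Wq Wb; unwalk.
  apply: (@shuf_null _ _ tl hd _
    ((a ++ q1 ++ y :: b ++ q1) ++ (x :: q2) ++ (x :: q2) ++ c' ++ e)).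
    have := @shuf_swap_mid _ _ tl hd s (tl x) (a ++ q1) (x :: q2) (y :: b ++ q1)
      (x :: q2 ++ c' ++ e).
    by catn; apply; wk.
  by apply: (null_mid (u := s) (v := tl x)) => //; wk.
have [Eu Wb'] := walk_consP Wb.
have [yq|yq] := boolP (y \in q); first by left; apply: (loop_in_q y).
have [yb|yb] := boolP (y \in b).
  right; case/splitPr: yb Wb' {Hy Hc W Wb loop_in_q} => b1 b2 Wb'.
  subst u; unwalk.
  exists a, (rcons q y), b2, (b1 ++ c); rewrite size_rcons -!cats1; split=> //.
    by wk.
  have := @shuf_swap_mid _ _ tl hd s (tl y) (a ++ q) (y :: b1) (y :: b2 ++ q) (c ++ e).
  by catn; apply; wk.
rewrite (negbTE yq) (negbTE yb) /= in Hy.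
case: c => [|z c] in ac W Wc Hc Hy *.
  by move: ac Hy => /= /eqP->.
have [Ez Wc'] := walk_consP Wc.
have [zy|zy] := eqVneq z y.
  subst z; right; exists a, (rcons q y), b, c; rewrite size_rcons -!cats1.
  subst u; split=> //; first by wk.
  by catn; exact: shuf_refl.
have Hz : [|| z \in a, z \in q, z \in b | z \in c].
  have := Hc z; rewrite !mem_cat mem_head !orbT => /(_ isT).
  rewrite !count_cat /= eqxx => H.
  move: H; rewrite eq_sym (negbTE zy) => H.
  by rewrite -4!(has_pred1 z) !has_count; move: H; clear; lia.
have [zq|zq] := boolP (z \in q); first by left; apply: (loop_in_q z).
have [zc|zc] := boolP (z \in c).
  right; case/splitPr: zc Wc' {Hy Hc W Wc Hz loop_in_q} => c1 c2 Wc'.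
  subst u; unwalk.
  exists a, (rcons q z), (c1 ++ y :: b), c2; rewrite size_rcons -!cats1.
  split=> //; first by wk.
  have := @shuf_swap_mid _ _ tl hd s (tl z) (a ++ q) (y :: b ++ q) (z :: c1)
    (z :: c2 ++ e).
  by catn; apply; wk.
have [za|za] := boolP (z \in a).
  right; case/splitPr: za Wa {Hy Hc W ac Hz loop_in_q} => a1 a2 Wa.
  subst u; unwalk.
  exists (a1 ++ y :: b), (rcons q z), a2, c; rewrite size_rcons -!cats1.
  split=> //; first by wk.
  have := @shuf_swap_mid _ _ tl hd s (tl z) a1 (z :: a2 ++ q) (y :: b ++ q)
    (z :: c ++ e).
  by catn; apply; wk.
(* Now [z] recurs only in [b], and [y] only in [a] or [c]. Either way a swap puts [y] behind both
   copies of [q]. *)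
rewrite (negbTE za) (negbTE zq) (negbTE zc) orbF /= in Hz.
rewrite inE eq_sym (negbTE zy) /= in Hy.
right; case/splitPr: Hz Wb' {Hc W Wb loop_in_q yb} => b1 b2 Wb'.
have [yc|yc] := boolP (y \in c).
  case/splitPr: yc Wc' {Hy Wc zc} => c1 c2 Wc'.
  subst u; unwalk.
  exists a, (rcons q y), (b1 ++ z :: c1 ++ z :: b2), c2; rewrite size_rcons -!cats1.
  split=> //; first by wk.
  have := @shuf_swap_mid _ _ tl hd s (tl y) (a ++ q ++ y :: b1) (z :: b2 ++ q) (z :: c1)
    (y :: c2 ++ e).
  by catn; apply; wk.
rewrite (negbTE yc) orbF in Hy.
case/splitPr: Hy Wa {ac za} => a1 a2 Wa.
subst u; unwalk.
exists (a1 ++ z :: b2), (rcons q y), a2, (b1 ++ z :: c); rewrite size_rcons -!cats1.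
split=> //; first by wk.
have := @shuf_swap_mid _ _ tl hd s (tl y) a1 (y :: a2 ++ q ++ y :: b1) (z :: b2 ++ q)
  (z :: c ++ e).
by catn; apply; wk.
Qed.


(** The missing case, [c] empty and [a] nonempty, is [grow_right] in the opposite quiver, where [a]
    and [c] trade places. *)
Lemma grow tl hd s t a q b c e : q != [::] ->
  walk tl hd s (a ++ q ++ b ++ q ++ c) t -> walk tl hd t e s ->
  (forall x, x \in a ++ q ++ b ++ q ++ c ->
     1 < count_mem x (a ++ q ++ b ++ q ++ c)) ->
  null tl hd ((a ++ q ++ b ++ q ++ c) ++ e) \/
  exists a' q' b' c', [/\ size q' = (size q).+1,
    walk tl hd s (a' ++ q' ++ b' ++ q' ++ c') t &
    shuf tl hd ((a ++ q ++ b ++ q ++ c) ++ e)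
               ((a' ++ q' ++ b' ++ q' ++ c') ++ e)].
Proof.
move=> Nq W We Hc.
have [ac|] := boolP ((c != [::]) || (a == [::])); first exact: grow_right.
rewrite negb_or negbK => /andP[/eqP Ec _].
have revE p1 p2 p3 p4 p5 :
    rev (p1 ++ p2 ++ p3 ++ p4 ++ p5) =
    rev p5 ++ rev p4 ++ rev p3 ++ rev p2 ++ rev p1 :> seq A.
  by rewrite !rev_cat -!catA.
have := @grow_right hd tl t s (rev c) (rev q) (rev b) (rev a) (rev e).
rewrite -!revE; case.
- by rewrite -size_eq0 size_rev size_eq0.
- by rewrite Ec /= eqxx orbT.
- exact: walk_rev.
- exact: walk_rev.
- by move=> x; rewrite mem_rev count_rev; apply: Hc.
- move=> /null_rev; rewrite rev_cat !revK => N; left; apply: shuf_null N.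
  exact: shuf_rot W We.
case=> [a' [q' [b' [c' [Sq W' /shuf_rev S]]]]].
right; exists (rev c'), (rev q'), (rev b'), (rev a').
rewrite -!revE !size_rev in Sq *; split=> //; first exact: walk_rev.
apply: (shuf_trans (shuf_rot W We)).
move: S; rewrite !rev_cat !revK -!rev_cat => S; apply: (shuf_trans S).
by apply: (shuf_rot We); apply: walk_rev.
Qed.

(* Growing a repeated factor of [p] as long as possible makes it overlap
   itself, that is, produces a square of a loop. *)
Lemma null_of_repeats tl hd s t p e : p != [::] ->
  walk tl hd s p t -> walk tl hd t e s ->
  (forall x, x \in p -> 1 < count_mem x p) -> null tl hd (p ++ e).
Proof.
move=> Np Wp We Hp.
(* [n] exceeds the length outside one copy of [q], which shrinks: the total length is constant while
   [q] grows. *)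
have gen n a q b c : q != [::] -> size (a ++ q ++ b ++ q ++ c) < size q + n ->
    walk tl hd s (a ++ q ++ b ++ q ++ c) t ->
    (forall x, x \in a ++ q ++ b ++ q ++ c ->
       1 < count_mem x (a ++ q ++ b ++ q ++ c)) ->
    null tl hd ((a ++ q ++ b ++ q ++ c) ++ e).
  elim: n a q b c => [|n IH] a q b c Nq Hn W Hc.
    by move: Hn; rewrite !size_cat; lia.
  have [//|[a' [q' [b' [c' [Sq W' S]]]]]] := grow Nq W We Hc.
  apply: (shuf_null S).
  have := shuf_perm S; rewrite perm_cat2r => P.
  apply: IH => //; first by rewrite -size_eq0 Sq.
    by rewrite -(perm_size P) Sq; lia.
  by move=> x; rewrite -(perm_mem P) -(permP P); apply: Hc.
case: p Np Wp Hp => // x p _ Wp Hp.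
have := Hp x (mem_head _ _) => /count2_split[a [b [c E]]].
rewrite E -[x :: b ++ x :: c]/([:: x] ++ b ++ [:: x] ++ c) in Wp Hp *.
by apply: (gen (size (a ++ [:: x] ++ b ++ [:: x] ++ c))).
Qed.

End Reversal.

(** * Peeling off a primitive loop with an arrow of its own *)

Section Peeling.
Variables (V A : eqType) (tl hd : A -> V).
Implicit Types (u v w s t : V) (x y z : A).
Implicit Types (p q r a b c e f g h k : seq A).
Local Notation walk := (walk tl hd).
Local Notation shuf := (shuf tl hd).
Local Notation null := (null tl hd).

Lemma run_right (P : pred A) p : exists p1 p2,
  [/\ p = p1 ++ p2, all P p1 & if p2 is x :: _ then ~~ P x else true].
Proof.
elim: p => [|x p [p1 [p2 [-> H1 H2]]]]; first by exists [::], [::].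
have [Px|Px] := boolP (P x); last by exists [::], (x :: p1 ++ p2).
by exists (x :: p1), p2; rewrite /= Px.
Qed.

Lemma run_left (P : pred A) p : exists p1 p2,
  [/\ p = p1 ++ p2, all P p2 & forall p' x, p1 = rcons p' x -> ~~ P x].
Proof.
have [p1 [p2 [E H1 H2]]] := run_right P (rev p).
exists (rev p2), (rev p1); rewrite -rev_cat -E revK all_rev; split=> // p' x Ep.
by move: H2; rewrite -[p2]revK Ep rev_rcons.
Qed.

Lemma peel_simple h v : ~ null h -> h != [::] -> walk v h v ->
  exists u e h' y, [/\ walk u e u, walk u h' u, shuf h (e ++ h'),
    uniq (map hd e) & (y \in e) && (y \notin h')].
Proof.
move=> Nh N0 Wh.
have [y [yh cy]] : exists y, y \in h /\ count_mem y h = 1.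
  have [/hasP[y yh /eqP cy]|H] := boolP (has (fun y => count_mem y h == 1) h).
    by exists y.
  case: Nh; rewrite -[h]cats0; apply: (null_of_repeats N0 Wh (walk_nil _ _ v)).
  move=> x xh; have := hasPn H _ xh; have : 0 < count_mem x h.
    by rewrite -has_count has_pred1.
  by case: (count_mem x h) => [|[|]].
have gen n u e h' : size e < n -> walk u e u -> walk u h' u -> shuf h (e ++ h') ->
    forall y, y \in e -> count_mem y h = 1 ->
  exists u e h' y, [/\ walk u e u, walk u h' u, shuf h (e ++ h'),
    uniq (map hd e) & (y \in e) && (y \notin h')]; last first.
  by apply: (gen _ v h [::] (ltnSn _)) yh cy; rewrite ?cats0 //;
     [exact: walk_nil | exact: shuf_refl].
clear y yh cy; elim: n u e h' => // n IH u e h' Hn We Wh' S y ye cy.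
have cE x : count_mem x h = count_mem x e + count_mem x h'.
  by rewrite (permP (shuf_perm S)) count_cat.
have [Ue|/(nonuniq_loop We)] := boolP (uniq (map hd e)).
  exists u, e, h', y; split=> //; rewrite ye /=; apply/count_memPn.
  have : 0 < count_mem y e by rewrite -has_count has_pred1.
  by have := cE y; rewrite cy; clear; lia.
case=> [w0 [p1 [q [p2 [Ee Nq Np1 Wq [W1 W2]]]]]].
(* Either a shorter loop through an arrow of multiplicity one exists, or [e] is shortest although it
   has the proper subloop [q]; the latter is refuted. *)
have [[u' [e' [h'' [y' [Hs We' Wh'' S' [ye' cy']]]]]]|Hmin] := classic
    (exists u e' h' y, [/\ size e' < size e, walk u e' u, walk u h' u,
      shuf h (e' ++ h') & y \in e' /\ count_mem y h = 1]).
  exact: (IH u' e' h'' (leq_trans Hs Hn) We' Wh'' S' y' ye' cy').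
exfalso.
(* Otherwise [f] would be a shorter choice of [e]. *)
have loopA w e1 f e2 z : e = e1 ++ f ++ e2 -> f != [::] -> walk w f w ->
    size f < size e -> z \in f -> count_mem z h <> 1.
  move=> E Nf Wf Hs zf cz; case: Hmin.
  have [w1 [We1 W']] : exists w1, walk u e1 w1 /\ walk w1 (f ++ e2) u.
    by apply/walk_catP; rewrite -E.
  have [w2 [Wf' We2]] := walk_catP W'.
  have Ew := walk_start Nf Wf Wf'; subst w1.
  have Ew := walk_end Wf Wf'; subst w2.
  exists w, f, (e2 ++ h' ++ e1), z; split=> //; first by wk.
  apply: (shuf_trans S); rewrite E.
  by have := @shuf_rot _ _ tl hd u w e1 (f ++ e2 ++ h'); catn; apply; wk.
(* Otherwise [f] could be moved into [h'], leaving the shorter loop [e1 e2], still through [y]. *)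
have loopB w e1 f e2 : e = e1 ++ f ++ e2 -> f != [::] -> walk w f w ->
    size f < size e -> w \notin u :: map hd h'.
  move=> E Nf Wf Hs; apply/negP=> wh.
  have yf : y \notin f by apply/negP=> /(loopA w e1 f e2 y E Nf Wf Hs).
  have [w1 [We1 W']] : exists w1, walk u e1 w1 /\ walk w1 (f ++ e2) u.
    by apply/walk_catP; rewrite -E.
  have [w2 [Wf' We2]] := walk_catP W'.
  have Ew := walk_start Nf Wf Wf'; subst w1.
  have Ew := walk_end Wf Wf'; subst w2.
  have [h1 [h2 [Eh Wh1 Wh2]]] := walk_split Wh' wh.
  case: Hmin; exists u, (e1 ++ e2), (h1 ++ f ++ h2), y; split.
  - by rewrite E !size_cat; case: (f) Nf => //= *; clear; lia.
  - by wk.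
  - by wk.
  - apply: (shuf_trans S); rewrite E Eh.
    by have := @shuf_swap_mid _ _ tl hd u w e1 f (e2 ++ h1) h2; catn; apply; wk.
  - by split=> //; move: ye; rewrite E !mem_cat (negbTE yf).
have tail_good z : z \in e -> tl z \notin u :: map hd h' ->
    count_mem z h <> 1 -> 1 < count_mem z e.
  move=> ze zt; rewrite cE.
  have : 0 < count_mem z e by rewrite -has_count has_pred1.
  have /count_memPn -> : z \notin h' by apply: contra zt; apply: walk_tl Wh'.
  by clear; lia.
have loopC w e1 f e2 z : e = e1 ++ f ++ e2 -> f != [::] -> walk w f w ->
    size f < size e -> z \in f -> 1 < count_mem z e.
  move=> E Nf Wf Hs zf.
  have fe z' : z' \in f -> z' \in e by rewrite E !mem_cat => ->; rewrite orbT.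
  (* Induction along [f]: an arrow with tail off [h'] recurs in [e], and the stretch between two
     occurrences is a proper subloop based at its head, so that vertex is off [h'] too. *)
  have tails f1 z' f2 : f = f1 ++ z' :: f2 -> tl z' \notin u :: map hd h'.
    elim/last_ind: f1 z' f2 => [|f1 z1 IHf] z' f2 Ef.
      have -> : tl z' = w by move: Wf; rewrite Ef => /walk_consP[].
      exact: (loopB w e1 f e2).
    rewrite cat_rcons in Ef; have zt := IHf _ _ Ef.
    have z1f : z1 \in f by rewrite Ef mem_cat mem_head orbT.
    have /count2_split[r1 [r2 [r3 Er]]] :=
      tail_good _ (fe _ z1f) zt (loopA _ _ _ _ _ E Nf Wf Hs z1f).
    have <- : hd z1 = tl z' by rewrite Ef in Wf; unwalk.
    apply: (loopB (hd z1) (r1 ++ [:: z1]) (r2 ++ [:: z1]) r3).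
    + by rewrite Er -!catA.
    + by case: (r2).
    + by rewrite Er in We; unwalk; wk.
    + by rewrite Er !size_cat /= size_cat /=; clear; lia.
  apply: tail_good; first exact: fe.
    by case/splitPr: zf tails {fe Nf Wf Hs E} => f1 f2 tails; apply: (tails f1 z f2).
  exact: (loopA w e1 f e2).
pose good z := 1 < count_mem z e.
have [P1 [P2 [EP HP2 HP1]]] := run_left good p1.
have [S1 [S2 [ES HS1 HS2]]] := run_right good p2.
have Eq : size q < size e.
  by rewrite Ee !size_cat; case: (p1) Np1 => //= *; clear; lia.
(* [M] is the maximal run around [q] of arrows repeated in [e]. *)
have [M EM] : exists M, M = P2 ++ q ++ S1 by eexists.
have EeM : e = P1 ++ M ++ S2 by rewrite Ee EP ES EM -!catA.
have gM : all good M.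
  rewrite EM !all_cat HP2 HS1 andbT /=; apply/allP=> z.
  exact: (loopC w0 p1 q p2).
have NM : M != [::] by rewrite EM; case: (P2) (q) Nq => [|? ?] [].
have [m1 [WP1 W']] : exists w1, walk u P1 w1 /\ walk w1 (M ++ S2) u.
  by apply/walk_catP; rewrite -EeM.
have [m2 [WM WS2]] := walk_catP W'.
case: Nh; apply: (shuf_null S); rewrite EeM.
apply: (@shuf_null _ _ tl hd _ (M ++ (S2 ++ h' ++ P1))).
  by have := @shuf_rot _ _ tl hd u m1 P1 (M ++ S2 ++ h'); catn; apply; wk.
apply: (null_of_repeats NM WM); first by wk.
(* An arrow of [M] not repeated within [M] recurs in [P1] or [S2]. By [loopC] the loop between the
   two occurrences has only repeated arrows; it contains the arrow bordering [M], against
   maximality. *)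
move=> z zM; rewrite ltnNge; apply/negP=> cM.
have gz : good z by apply: (allP gM).
have : (z \in P1) || (z \in S2).
  rewrite -2!(has_pred1 z) !has_count; move: gz; rewrite /good EeM !count_cat.
  by move: cM; clear; lia.
clear EM cM gM.
case/orP=> zP.
  case/splitPr: zP WP1 EeM {EP} HP1 => r1 r2 WP1 EeM HP1.
  case/splitPr: zM WM EeM {NM W'} => n1 n2 WM EeM.
  have gf x : x \in z :: r2 ++ n1 -> good x.
    apply: (loopC (tl z) r1 _ (z :: n2 ++ S2)) => //.
    - by rewrite EeM; catn.
    - by unwalk; wk.
    - by rewrite EeM; catn; rewrite !size_cat /= !size_cat /=; clear; lia.
  case/lastP: r2 HP1 gf {WP1 EeM} => [|r2 x] HP1 gf.
    by have := HP1 r1 z; rewrite cats1 gz => /(_ erefl).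
  have := HP1 (r1 ++ z :: r2) x; rewrite rcons_cat /= => /(_ erefl).
  by rewrite gf // inE mem_cat mem_rcons mem_head orbT.
case/splitPr: zP WS2 EeM {ES} HS2 => r1 r2 WS2 EeM HS2.
case/splitPr: zM WM EeM {NM W'} => n1 n2 WM EeM.
have gf x : x \in z :: n2 ++ r1 -> good x.
  apply: (loopC (tl z) (P1 ++ n1) _ (z :: r2)) => //.
  - by rewrite EeM; catn.
  - by unwalk; wk.
  - by rewrite EeM; catn; rewrite !size_cat /= !size_cat /=; clear; lia.
case: r1 HS2 gf {WS2 EeM} => [|x r1] /= HS2 gf; first by rewrite gz in HS2.
by rewrite gf // inE mem_cat mem_head !orbT in HS2.
Qed.

End Peeling.

(** * Counting arrows and vertices of closed paths *)

Section Counting.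
Variables (V A : finType) (tl hd : A -> V).
Implicit Types (p q : seq A).

Definition arrows p : {set A} := [set x in p].
(** For a nonempty closed path this is its vertex set. *)
Definition tails p : {set V} := [set tl x | x in arrows p].

Lemma mem_tails p x : x \in p -> tl x \in tails p.
Proof. by move=> xp; apply: imset_f; rewrite inE. Qed.

Lemma card_tails p : #|tails p| <= #|arrows p|.
Proof. exact: leq_imset_card. Qed.

Lemma tails_heads u p v : walk tl hd u p u -> (v \in tails p) = (v \in map hd p).
Proof.
case: p => [|y p] W.
  by rewrite in_nil; apply/imsetP => -[x]; rewrite inE.
have [Eu _] := walk_consP W.
apply/imsetP/mapP => -[x]; rewrite ?inE => xp ->.
  have := walk_tl W xp; rewrite (closed_heads _ W) // => /mapP[z zp ->].
  by exists z.
have : hd x \in u :: map hd (y :: p) by rewrite inE map_f ?orbT.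
case/(walk_split W) => p1 [p2 [Ep W1]].
case: p2 Ep => [|z p2] Ep W2.
  move/eqP: W2 => ->; exists y; last exact: Eu.
  by rewrite inE mem_head.
have [-> _] := walk_consP W2; exists z => //.
by rewrite inE Ep mem_cat mem_head orbT.
Qed.

(** Without an entering arrow, the walk stays outside [B] from [x] to its end [u]; restarted at [u],
    it never meets [B]. *)
Lemma enter_set u p (B : {set V}) x y : walk tl hd u p u ->
  x \in p -> tl x \notin B -> y \in p -> tl y \in B ->
  exists2 z, z \in p & (tl z \notin B) && (hd z \in B).
Proof.
move=> W xp xB yp yB; apply/hasP/negPn/negP=> /hasPn H.
have out v w q : {subset q <= p} -> walk tl hd v q w -> v \notin B ->
    {in q, forall z, tl z \notin B} /\ w \notin B.
  elim: q v => [|z q IH] v qp; first by move/eqP->.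
  case/walk_consP=> -> Wq zB.
  have zB' : hd z \notin B.
    by have := H z (qp _ (mem_head _ _)); rewrite zB.
  have qp' : {subset q <= p} by move=> t tq; apply: qp; rewrite inE tq orbT.
  have [IH1 IH2] := IH _ qp' Wq zB'; split=> // t; rewrite inE.
  by case/orP=> [/eqP->|/IH1].
have uB : u \notin B.
  case/splitPr: xp W out {H yp} => p1 p2 W out.
  have [w [_ W2]] := walk_catP W.
  have Ew := (walk_consP W2).1; subst w.
  apply: (out _ _ _ _ W2 xB).2 => t tp.
  by rewrite mem_cat tp orbT.
have [Ht _] := out _ _ _ (fun _ => id) W uB.
by move: (Ht _ yp); rewrite yB.
Qed.

(* Each vertex of [p] missed by [q] is the head of an arrow of [p] missed by
   [q], and one more such arrow is needed to come back to the vertices of [q]. *)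
Lemma card_closed_proper u v p q y : walk tl hd u p u -> walk tl hd v q v ->
  q != [::] -> {subset q <= p} -> y \in p -> y \notin q ->
  #|arrows q| + #|tails p| < #|arrows p| + #|tails q|.
Proof.
move=> Wp Wq Nq qp yp yq.
have sA : arrows q \subset arrows p by apply/subsetP=> x; rewrite !inE; apply: qp.
have sV : tails q \subset tails p by apply: imsetS.
(* The spare arrow [z] comes back to the vertices of [q], or is [y] if [p] has no other vertices. *)
have [z zT zU] : exists2 z, z \in arrows p :\: arrows q &
    hd z \notin tails p :\: tails q.
  have [E|] := eqVneq (tails p :\: tails q) set0.
    by exists y; rewrite ?E ?inE // yq.
  case/set0Pn=> w; rewrite inE => /andP[wq /imsetP[x]].
  rewrite inE => xp Ew; subst w.
  case: q Nq qp wq {Wq yq sA sV} => // t q _ qp wq.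
  have := enter_set Wp xp wq (qp _ (mem_head _ _)) (mem_tails (mem_head _ _)).
  case=> z zp /andP[z1 z2]; exists z; last by rewrite inE z2.
  by rewrite !inE zp andbT; apply: contra z1 => zq; apply: mem_tails.
have sU : tails p :\: tails q \subset hd @: ((arrows p :\: arrows q) :\ z).
  apply/subsetP=> w wU; move: (wU); rewrite inE (tails_heads _ Wp) => /andP[wq].
  case/mapP=> x xp Ew; apply/imsetP; exists x => //.
  rewrite !inE xp andbT; apply/andP; split.
    by apply: contraNneq zU => <-; rewrite -Ew.
  by apply: contra wq => xq; rewrite (tails_heads _ Wq) Ew map_f.
have := leq_trans (subset_leq_card sU) (leq_imset_card _ _).
have := cardsD1 z (arrows p :\: arrows q); rewrite zT.
have := cardsID (arrows q) (arrows p); rewrite (setIidPr sA).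
have := cardsID (tails q) (tails p); rewrite (setIidPr sV).
clear; lia.
Qed.

(** Each vertex off [p] is the head of some arrow, which cannot lie on [p]. *)
Lemma card_tails_full u p : (forall v, exists x, hd x = v) ->
  walk tl hd u p u -> #|arrows p| + #|V| <= #|A| + #|tails p|.
Proof.
move=> sur Wp.
have sU : ~: tails p \subset hd @: ~: arrows p.
  apply/subsetP=> w; rewrite inE (tails_heads _ Wp) => wp.
  have [x Ex] := sur w; apply/imsetP; exists x => //.
  by rewrite !inE; apply: contra wp => xp; rewrite -Ex map_f.
have := leq_trans (subset_leq_card sU) (leq_imset_card _ _).
have := cardsC (tails p); have := cardsC (arrows p).
clear; lia.
Qed.

End Counting.

(** * From shuffles to the equivalence, and the degree bound *)

Section Degree.
Variables (n d : nat) (tl hd : 'I_d -> 'I_n).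
Implicit Types (u v : 'I_n) (p q a b h : seq 'I_d).
Local Notation walk := (walk tl hd).

Lemma walkE u v x p : walk u (x :: p) v =
  [&& tl x == u, path (fun y z => hd y == tl z) x p & hd (last x p) == v].
Proof.
elim: p u x => [|y p IH] u x; first by [].
by rewrite -[LHS]/((tl x == u) && walk (hd x) (y :: p) v) IH (eq_sym (tl y)) /= -!andbA.
Qed.

Lemma walk_is_path u v p : p != [::] -> walk u p v -> is_path tl hd p.
Proof. by case: p => // x p _; rewrite walkE => /and3P[]. Qed.

Lemma walk_closed_in v p : p != [::] -> walk v p v -> closed_in tl hd v p.
Proof.
case: p => // x p _; rewrite walkE => /and3P[/eqP Ex H /eqP Ev].
by rewrite /closed_in /is_closed /is_path /= H Ev Ex !eqxx.
Qed.

Lemma closed_in_closed v p : closed_in tl hd v p -> is_closed tl hd p.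
Proof. by case: p => // x p /andP[]. Qed.

Lemma is_closed_walk p : is_closed tl hd p -> p != [::] /\ exists v, walk v p v.
Proof.
case: p => // x p /andP[/andP[_ H] E]; split=> //; exists (tl x).
by rewrite walkE eqxx eq_sym E /= andbT.
Qed.

(** The relations of [qequiv] concern nonempty paths, so empty blocks are split off; an empty [c]
    leaves a permutation of two loops instead of three. *)
Lemma shuf_qequiv h k : shuf tl hd h k -> qequiv tl hd (Some h) (Some k).
Proof.
elim=> {h k} [h|h h' k _ H1 _ H2|u v p q Wp Wq|v a b c Wa Wb Wc].
- exact: qe_refl.
- exact: qe_trans H1 H2.
- have [->|Np] := eqVneq p [::]; first by rewrite cats0; exact: qe_refl.
  have [->|Nq] := eqVneq q [::]; first by rewrite cats0; exact: qe_refl.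
  apply: qe_rot; [exact: walk_is_path Wp|exact: walk_is_path Wq|].
  apply: (closed_in_closed (v := u)); apply: walk_closed_in; last by wk.
  by case: (p) Np.
- have [->|Na] := eqVneq a [::]; first exact: qe_refl.
  have [->|Nb] := eqVneq b [::]; first exact: qe_refl.
  have Ha := walk_closed_in Na Wa; have Hb := walk_closed_in Nb Wb.
  have [->|Nc] := eqVneq c [::].
    have P : perm_eq [:: b; a] [:: a; b] by apply/permPl/(perm_catC [:: b] [:: a]).
    by apply: (qe_perm (v := v) _ _ P) => //=; rewrite Ha Hb.
  have Hc := walk_closed_in Nc Wc.
  have P : perm_eq [:: b; a; c] [:: a; b; c].
    by apply/permPl/(perm_catCA [:: b] [:: a] [:: c]).
  have := qe_perm (tl := tl) (hd := hd) (v := v) _ _ P; rewrite /= cats0.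
  by apply; rewrite ?Ha ?Hb ?Hc.
Qed.

Lemma null_qequiv h : null tl hd h -> qequiv tl hd (Some h) None.
Proof.
case=> v [a [b [Na Wa Wb S]]]; apply: (qe_trans (shuf_qequiv S)).
have Ha := walk_closed_in Na Wa.
have [->|Nb] := eqVneq b [::].
  by rewrite cats0; apply: qe_sq; apply: closed_in_closed Ha.
exact: qe_sq_mul Ha (walk_closed_in Nb Wb).
Qed.

Lemma simple_primitive u p : p != [::] -> walk u p u -> uniq (map hd p) ->
  primitive tl hd p.
Proof.
move=> Np W U; rewrite /primitive (closed_in_closed (walk_closed_in Np W)) /=.
apply/allP=> w wp; have : w \in u :: map hd p.
  by case: p W wp {Np U} => // x p /walk_consP[-> _].
rewrite (closed_heads Np W) => wh.
have := count_uniq_mem w U; rewrite wh count_map => E.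
by apply/eqP; exact: E.
Qed.

(** Each round removes [e] and at most [m] further arrows, so at most [2 * m], while arrows minus
    vertices drops. *)
Lemma size_not_null m u h : (forall p, primitive tl hd p -> size p <= m) ->
  h != [::] -> walk u h u -> ~ null tl hd h ->
  size h <= 2 * m * (#|arrows h| - #|tails tl h|) + m.
Proof.
move=> Hm.
have Hm' v a : a != [::] -> walk v a v -> uniq (map hd a) -> size a <= m.
  by move=> Na Wa Ua; apply: Hm; apply: simple_primitive Wa Ua.
have [l] := ubnP (size h); elim: l h u => // l IH h u Hl N0 W Nh.
have [v [e [h' [y [We Wh' S Ue /andP[ye yh']]]]]] := peel_simple Nh N0 W.
have Ne : e != [::] by case: (e) ye.
have He := Hm' _ _ Ne We Ue.
have Sh := perm_size (shuf_perm S); rewrite size_cat in Sh.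
(* If nothing remains, [h] is a shuffle of the primitive [e]: this is the final summand [m]. *)
have [E|Nh'] := eqVneq h' [::].
  rewrite Sh E addn0; apply: leq_trans He _; exact: leq_addl.
have [w [k [Nk Wk Nnk sk /andP[Hkh Hk]]]] := null_remove Hm' Nh Nh' We Wh' S.
have kh : {subset k <= h}.
  by move=> x /sk xh'; rewrite (perm_mem (shuf_perm S)) mem_cat xh' orbT.
have yh : y \in h by rewrite (perm_mem (shuf_perm S)) mem_cat ye.
have yk : y \notin k by apply: contra yh'; apply: sk.
have C := card_closed_proper W Wk Nk kh yh yk.
(* Vertices never outnumber arrows, so the truncated subtractions are exact. *)
have kT := card_tails tl k; have hT := card_tails tl h.
have e0 : 0 < size e by case: (e) Ne.
have Hs : size k < l by move: Hl Hkh e0; rewrite Sh; clear; lia.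
have := IH _ _ Hs Nk Wk Nnk.
move: C kT hT Hk He; rewrite Sh; clear.
set Ak := #|arrows k|; set Ah := #|arrows h|.
set Vk := #|tails tl k|; set Vh := #|tails tl h|; move=> C kT hT Hk He Hi.
have : 2 * m * (Ak - Vk).+1 <= 2 * m * (Ah - Vh).
  by rewrite leq_mul2l; apply/orP; right; move: C kT hT; clear; lia.
rewrite mulnS; move: Hi Hk He.
move: (2 * m * (Ak - Vk)) (2 * m * (Ah - Vh)) => X Y.
by move: (size e) (size h') (size k) => x y z; clear; lia.
Qed.

End Degree.

Theorem theorem6p2 (K : fieldType)
  (K_infinite : forall s : seq K, exists x : K, x \notin s)
  (K_char2 : (2%N \in [pchar K]%R))
  (n d m : nat) (tl hd : 'I_d -> 'I_n)
  (HQ : in_Qndm tl hd m)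
  (h : seq 'I_d) (Hh : is_closed tl hd h)
  (Hh0 : ~ qequiv tl hd (Some h) None) :
  size h <= 2 * m * (d - n) + m.
Proof.
have [[p [Hp pV]] [_ Hm]] := HQ.
have [Nh [u Wh]] := is_closed_walk Hh.
have [Np [v Wp]] := is_closed_walk Hp.
have Nu : ~ null tl hd h by move/null_qequiv.
(* The closed path through all vertices enters each of them. *)
have sur w : exists x, hd x = w.
  have : w \in v :: map hd p.
    by case: (p) Wp (pV w) => // x q /walk_consP[-> _].
  by rewrite (closed_heads Np Wp) => /mapP[x _ ->]; exists x.
have := card_tails_full sur Wh; rewrite !card_ord => C.
have hT := card_tails tl h.
apply: leq_trans (size_not_null Hm Nh Wh Nu) _.
rewrite leq_add2r leq_mul2l; apply/orP; right.
by move: C hT; clear; lia.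
Qed.
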